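(* In the i.i.d. setting, let $(E_n)_{n\in\mathbb{N}}$ be i.i.d. under $\mathbb{P}_1$, generated by a single e-variable $E$ with $\mathbb{E}_{P_1}|\log E|<\infty$ and $c:=\mathbb{E}_{P_1}[\log E]>0$. Write $$\Lambda_s(E):=-\log\mathbb{E}_{P_1}[E^{-s}],\qquad\Lambda(E):=\sup_{s\ge0}\Lambda_s(E)\in[0,\infty],$$ the tilted exponent at tilt $s$ and the Chernoff–Stein exponent of $E$. Then $$\psi(s):=\varphi(s)=sc-\Lambda_s(E)$$ is a majorant, with equality in the defining inequality of a majorant, so no majorant is smaller; the rate function is $\psi^{\star}(x)=\sup_{s\ge0}\{\Lambda_s(E)-s(c-x)\}$; the optimising tilt solves $$\mathbb{E}_{Q_s}[\log E]=\frac{\ell}{t},\qquad\frac{dQ_s}{dP_1}:=\frac{E^{-s}}{\mathbb{E}_{P_1}[E^{-s}]};$$ and $$\gamma_t(\alpha)\le\exp\Big(-\sup_{s\ge0}\{t\,\Lambda_s(E)-s\ell\}\Big).$$ If moreover $0$ is interior to $\{x\in\mathbb{R}:I(x)<\infty\}$, $I$ being the Cramér rate function of $\log E$ under $P_1$, then this bound is exact on the exponential scale, by Cramér's theorem: $$\lim_{t\to\infty}\frac1t\log\gamma_t(\alpha)=-\Lambda(E)\qquad\text{for every fixed }\alpha\in(0,1).$$ For the sequential error, this and the inequality $\bar\gamma_t(\alpha)\le\gamma_t(\alpha)$ give one half, $$\liminf_{t\to\infty}-\frac1t\log\bar\gamma_t(\alpha)\ge\Lambda(E).$$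
   Context: I.i.d. setting: $(\mathcal{X},\mathcal{B})$ is a measurable space, $P_0,P_1$ are probability measures on it with $P_1\ll P_0$; $\Omega=\mathcal{X}^{\mathbb{N}}$ with coordinate process $(X_n)_{n\in\mathbb{N}}$, $\mathcal{F}_t=\sigma(X_1,\dots,X_t)$, $\mathbb{P}_i=P_i^{\otimes\mathbb{N}}$. An e-variable is a measurable $E:\mathcal{X}\to[0,\infty]$ with $\mathbb{E}_{P_0}[E]\le1$; the sequence it generates is $E_n=E(X_n)$. Wealth: $W_0=1$, $W_t=\prod_{n\le t}E_n$. For $\alpha\in(0,1)$ and $t\in\mathbb{N}$: $\ell:=\log\frac1\alpha$, $\tau_\alpha:=\inf\{t\in\mathbb{N}:W_t>\frac1\alpha\}$, $\gamma_t(\alpha):=\mathbb{P}_1(W_t\le\frac1\alpha)$ (fixed-horizon type-II error), $\bar\gamma_t(\alpha):=\mathbb{P}_1(\tau_\alpha>t)$ (sequential type-II error). Here $\varphi(s):=\log\mathbb{E}_{P_1}[e^{-s(\log E-c)}]$, which is the anchored conditional cumulant generating function $\log\mathbb{E}_{\mathbb{P}_1}[e^{-s(\log E_n-c)}\mid\mathcal{F}_{n-1}]$ of every step. A majorant is a function $\psi:[0,\infty)\to[0,\infty]$ with $\psi(0)=0$ and $\varphi(s)\le\psi(s)$ for all $s$; its rate function is $\psi^{\star}(x):=\sup_{s\ge0}\{sx-\psi(s)\}$, $x\ge0$. The optimising tilt is the maximiser of $s\mapsto t\Lambda_s(E)-s\ell$ over $s\ge0$. The Cramér rate function is $I(x):=\sup_{\lambda\in\mathbb{R}}\{\lambda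 x-\log\mathbb{E}_{P_1}[E^{\lambda}]\}$. Conventions: $\log$ natural, $-\log(+\infty)=-\infty$. Terminology (quoted in the paper from a companion paper, as description only): $\Lambda(E)$ is the exponent $E$ achieves at fixed level as $t\to\infty$; its supremum over all e-variables is the classical Chernoff–Stein exponent $\mathrm{KL}(P_0\|P_1)$; at $E=dP_1/dP_0$ it is the Chernoff information of the pair.
   Formalization: The equation for the optimising tilt is stated only for a maximiser s interior to {s ≥ 0 : Λ_s(E) > −∞}; at a boundary maximiser it can fail, e.g. s = 0 when ℓ/t > c, where E_{Q_0}[log E] = c. *)

(* Defs.v *)
From HB Require Import structures.
From mathcomp Require Export all_boot all_order all_algebra.
From mathcomp Require Export all_classical all_reals all_analysis.
From mathcomp Require Export measurable_realfun.
Set Implicit Arguments.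
Unset Strict Implicit.
Unset Printing Implicit Defensive.
Export Order.TTheory GRing.Theory Num.Theory.
Export numFieldNormedType.Exports.
Local Open Scope classical_set_scope.
Local Open Scope ring_scope.
Local Open Scope ereal_scope.

Section measurability.
Context {R : realType}.

Lemma measurable_lne : measurable_fun [set: \bar R] (@lne R).
Proof.
have -> : @lne R = fun x => if x <= 0 then -oo
    else if x == +oo then +oo else (ln (fine x))%:E.
  by apply/funext => -[r| |]//=; rewrite ?lee_fin ?leNye.
apply: measurable_fun_ifT => //; first exact: measurable_fun_lee.
apply: measurable_fun_ifT => //; first exact: measurable_fun_eqe.
by apply/measurable_EFinP; apply: measurableT_comp.
Qed.

Lemma measurable_expeR : measurable_fun [set: \bar R] (@expeR R).
Proof.
have -> : @expeR R = fun x => if x == -oo then 0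
    else if x == +oo then +oo else (expR (fine x))%:E.
  by apply/funext => -[r| |]//=; rewrite ?lee_fin ?leNye.
apply: measurable_fun_ifT => //; first exact: measurable_fun_eqe.
apply: measurable_fun_ifT => //; first exact: measurable_fun_eqe.
by apply/measurable_EFinP; apply: measurableT_comp.
Qed.

End measurability.

(* [epow y l] is y ^ l for y in [0, +oo], computed as exp (l * log y), so that
   epow 0 l = +oo and epow +oo l = 0 for l < 0, and epow y 0 = 1; the library's
   [poweR] gives 0 and +oo respectively for l < 0. *)
Definition epow {R : realType} (y : \bar R) (l : R) : \bar R :=
  expeR (l%:E * lne y).

Record evariable d (X : measurableType d) (R : realType)
    (P0 : probability X R) := EVariable {
  evar_fun :> X -> \bar R ;
  measurable_evar : measurable_fun [set: X] evar_fun ;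
  evar_ge0 : forall x, 0 <= evar_fun x ;
  evar_le1 : \int[P0]_x evar_fun x <= 1 }.

Section exponents.
Context d (X : measurableType d) (R : realType) (P0 P1 : probability X R).
Variable E : evariable P0.

Definition mean_log : \bar R := \int[P1]_x lne (E x).

Definition moment (l : R) : \bar R := \int[P1]_x epow (E x) l.

Definition tilted_exponent (s : R) : \bar R := - lne (moment (- s)).

Definition exponent : \bar R :=
  ereal_sup [set tilted_exponent s | s in [set s : R | (0 <= s)%R]].

(* Anchored cumulant generating function. *)
Definition acgf (s : R) : \bar R :=
  lne (\int[P1]_x expeR ((- s)%:E * (lne (E x) - mean_log))).

(* Functions on [0, +oo[ are represented by functions on R of which only the
   values at nonnegative points are used. *)
Definition majorant (psi : R -> \bar R) : Prop :=
  [/\ forall s : R, (0 <= s)%R -> 0 <= psi s,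
      psi 0%R = 0 &
      forall s : R, (0 <= s)%R -> acgf s <= psi s].

Definition rate (psi : R -> \bar R) (x : R) : \bar R :=
  ereal_sup [set (s * x)%:E - psi s | s in [set s : R | (0 <= s)%R]].

Definition tilt_objective (t : nat) (ell s : R) : \bar R :=
  t%:R%:E * tilted_exponent s - (s * ell)%:E.

Definition optimising_tilt (t : nat) (ell s : R) : Prop :=
  (0 <= s)%R /\
  forall u : R, (0 <= u)%R -> tilt_objective t ell u <= tilt_objective t ell s.

Definition cramer_rate (x : R) : \bar R :=
  ereal_sup [set (l * x)%:E - lne (moment l) | l in [set: R]].

Definition tilted_density (s : R) (x : X) : \bar R :=
  epow (E x) (- s) / moment (- s).

Definition tilted (s : R) (A : set X) : \bar R :=
  \int[P1]_(x in A) tilted_density s x.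

Lemma tilted_density_ge0 s x : 0 <= tilted_density s x.
Proof.
rewrite /tilted_density mule_ge0 ?expeR_ge0// inve_ge0.
by apply: integral_ge0 => y _; exact: expeR_ge0.
Qed.

Lemma measurable_tilted_density s :
  measurable_fun [set: X] (tilted_density s).
Proof.
apply: emeasurable_funM => //; apply: measurableT_comp.
  exact: measurable_expeR.
apply: emeasurable_funM => //; apply: measurableT_comp.
  exact: measurable_lne.
exact: measurable_evar.
Qed.

Let tilted0 s : tilted s set0 = 0.
Proof. exact: integral_set0. Qed.

Let tilted_ge0 s A : 0 <= tilted s A.
Proof. by apply: integral_ge0 => x _; exact: tilted_density_ge0. Qed.

Let tilted_sigma_additive s : semi_sigma_additive (tilted s).
Proof.
apply: semi_sigma_additive_nng_induced; first exact: measurable_tilted_density.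
exact: tilted_density_ge0.
Qed.

HB.instance Definition _ s := isMeasure.Build _ _ _
  (tilted s) (tilted0 s) (tilted_ge0 s) (@tilted_sigma_additive s).

End exponents.

(* The product sigma-algebra on X^N, generated by the coordinates. The
   coordinate w n is the observation X_(n+1). *)
Definition coordinate_events d (X : measurableType d) : set (set (nat -> X)) :=
  \bigcup_n preimage_set_system setT (fun w : nat -> X => w n) measurable.

Definition sequence_space d (X : measurableType d) :=
  g_sigma_algebraType (@coordinate_events d X).

(* PP is the infinite product of copies of P: it is the only probability with
   these values on the measurable rectangles. *)
Definition infinite_product d (X : measurableType d) (R : realType)
    (P : probability X R) (PP : probability (sequence_space X) R) : Prop :=
  forall (n : nat) (A : nat -> set X), (forall i, measurable (A i)) ->
    PP [set w : nat -> X | forall i, (i < n)%N -> A i (w i)] =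
    \prod_(i < n) P (A i).

Section errors.
Context d (X : measurableType d) (R : realType) (P0 : probability X R).
Variables (E : evariable P0) (PP1 : probability (sequence_space X) R).

Definition wealth (t : nat) (w : nat -> X) : \bar R := \prod_(n < t) E (w n).

Definition crossing_time (alpha : R) (w : nat -> X) : \bar R :=
  ereal_inf [set t%:R%:E | t in
    [set t : nat | (0 < t)%N /\ (alpha^-1)%:E < wealth t w]].

Definition type2_error (alpha : R) (t : nat) : \bar R :=
  PP1 [set w | wealth t w <= (alpha^-1)%:E].

Definition seq_type2_error (alpha : R) (t : nat) : \bar R :=
  PP1 [set w | t%:R%:E < crossing_time alpha w].

End errors.

(* Main.v *)
From HB Require Import structures.
Require Import Defs.
From mathcomp Require Import ring lra.
Set Implicit Arguments.
Unset Strict Implicit.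
Unset Printing Implicit Defensive.
Local Open Scope classical_set_scope.
Local Open Scope ring_scope.
Local Open Scope ereal_scope.

(* The wealth at time t is the exponential of a sum of t i.i.d. copies of
   log E, so the upper bound is Chernoff's inequality, and the equation for the
   optimising tilt is the vanishing of the derivative of an exponential moment.
   For Cramer's lower bound the law of log E, shifted by a small constant, is
   truncated and tilted at the minimiser of its exponential moment; the lower
   bound on the probability of a window around 0 then follows from the exact
   product formula for exponential moments, applied at three nearby tilts, so
   that neither a law of large numbers nor a tilted product measure is needed. *)

(** No exponential moment of log E is assumed finite, so the minimiser of its moment may sit at the
    edge of the domain of finiteness, where no derivative need vanish. Truncated moments are finite
    and smooth on the whole line and increase to the full ones. The hypothesis on I enters only
    through finiteness at 0, rho and - rho: a bound I(x) <= C says that the moment at every tilt u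
    is at least exp (u x - C). The two outer points push the moment above 1 at distant tilts of
    either sign, even after the shift, whereas the truncated moment at tilt 0 is at most 1; this
    traps a critical point in a compact interval. The value at 0 supplies the rate, and it equals
    Lambda(E) because c > 0 and Jensen's inequality confine the supremum in I(0) to nonpositive
    tilts. Two obstacles are of form: the product probability is specified on rectangles only, and
    log E may be infinite on a null set, so that sums of real logarithms represent the wealth only
    almost surely. *)

(** * Integration against the image of a measure with density *)

Section density.
Import HBNNSimple.
Context d d' (T : measurableType d) (T' : measurableType d') (R : realType).
Variables (mu : {measure set T -> \bar R}) (nu : {measure set T' -> \bar R}).
Variables (phi : T -> T') (h : T -> R).
Hypothesis mphi : measurable_fun [set: T] phi.
Hypothesis mh : measurable_fun [set: T] h.
Hypothesis h0 : forall x, (0 <= h x)%R.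
Hypothesis nuE : forall B, measurable B ->
  nu B = \int[mu]_(x in phi @^-1` B) (h x)%:E.

(** The hypothesis [nuE] says that [nu] is the image under [phi] of the measure with density [h]
    with respect to [mu]; both sides are compared on simple functions and passed to the limit by
    monotone convergence. It serves for [phi] a coordinate of the sequence space and for [phi] the
    identity, where [nu] is the tilted law. *)
Lemma ge0_integral_density (f : T' -> \bar R) :
    measurable_fun [set: T'] f -> (forall y, 0 <= f y) ->
  \int[nu]_y f y = \int[mu]_x (f (phi x) * (h x)%:E).
Proof.
move=> mf f0; pose g := nnsfun_approx measurableT mf.
have mpre B : measurable B -> measurable (phi @^-1` B).
  by move=> mB; rewrite -[X in measurable X]setTI; exact: mphi.
have mhE : measurable_fun [set: T] (EFin \o h) by exact/measurable_EFinP.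
have -> : \int[nu]_y f y = lim (\int[nu]_y (g n y)%:E @[n --> \oo]).
  rewrite -monotone_convergence//.
  - apply: eq_integral => y _; apply/esym/cvg_lim => //.
    exact: cvg_nnsfun_approx.
  - by move=> n; exact/measurable_EFinP.
  - by move=> n y _; rewrite lee_fin.
  - by move=> y _ a b ab; rewrite lee_fin; exact/lefP/nd_nnsfun_approx.
have -> : \int[mu]_x (f (phi x) * (h x)%:E) =
    lim (\int[mu]_x ((g n (phi x))%:E * (h x)%:E) @[n --> \oo]).
  rewrite -monotone_convergence//.
  - apply: eq_integral => x _; apply/esym/cvg_lim => //.
    apply: cvgeZr => //; exact: (@cvg_nnsfun_approx _ _ _ setT).
  - move=> n; apply: emeasurable_funM => //.
    by apply/measurable_EFinP; exact: measurableT_comp.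
  - by move=> n x _; rewrite mule_ge0 ?lee_fin.
  - move=> x _ a b ab; rewrite lee_wpmul2r ?lee_fin//.
    exact/lefP/nd_nnsfun_approx.
suff suf n : \int[nu]_y (g n y)%:E =
    \int[mu]_x ((g n (phi x))%:E * (h x)%:E).
  by under eq_fun do rewrite suf.
transitivity (\int[nu]_y (\sum_(r \in range (g n))
    (r * \1_(g n @^-1` [set r]) y)%:E)).
  by apply: eq_integral => y _; rewrite fsumEFin// -fimfunE.
have mI r : measurable_fun [set: T'] (\1_(g n @^-1` [set r]) : T' -> R).
  exact: measurable_indic.
rewrite ge0_integral_fsum//; last 2 first.
- by move=> r; apply/measurable_EFinP; exact: measurable_funM.
- by move=> r y _; exact: nnfun_muleindic_ge0.
transitivity (\int[mu]_x (\sum_(r \in range (g n))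
    (r * \1_(g n @^-1` [set r]) (phi x))%:E * (h x)%:E)); last first.
  apply: eq_integral => x _.
  rewrite -ge0_mule_fsuml => [|r]; last exact: nnfun_muleindic_ge0.
  by rewrite fsumEFin// -fimfunE.
rewrite ge0_integral_fsum//; last 2 first.
- move=> r; apply: emeasurable_funM => //.
  apply/measurable_EFinP; apply: measurable_funM => //.
  exact: measurableT_comp.
- by move=> r x _; rewrite mule_ge0 ?lee_fin// -lee_fin nnfun_muleindic_ge0.
apply: eq_fsbigr => r; rewrite inE => -[y _ <-].
under eq_integral do rewrite EFinM.
under [RHS]eq_integral do rewrite EFinM -muleA.
rewrite !ge0_integralZl//=; first last.
- by rewrite lee_fin.
- by apply/measurable_EFinP.
- by rewrite lee_fin.
- by move=> *; rewrite mule_ge0 ?lee_fin.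
- apply: emeasurable_funM => //; apply/measurable_EFinP.
  exact: measurableT_comp.
congr (_ * _); rewrite integral_indic// setIT nuE// [LHS]integral_mkcond.
apply: eq_integral => x _; rewrite muleC epatch_indic/=.
by congr (_ * _).
Qed.

(** Multiplication by the nonnegative [h] commutes with taking positive and negative parts, so the
    two halves match separately. *)
Lemma integral_density (f : T' -> \bar R) : measurable_fun [set: T'] f ->
  \int[nu]_y f y = \int[mu]_x (f (phi x) * (h x)%:E).
Proof.
move=> mf; rewrite [LHS]integralE [RHS]integralE.
have hE (x : T) : 0 <= (h x)%:E by rewrite lee_fin.
congr (_ - _).
  rewrite ge0_integral_density//; last exact: measurable_funepos.
  apply: eq_integral => x _; rewrite !funeposE.
  by rewrite muleC [in RHS]muleC maxe_pMr// mule0.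
rewrite ge0_integral_density//; last exact: measurable_funeneg.
apply: eq_integral => x _; rewrite !funenegE.
by rewrite muleC -mulNe [in RHS]muleC maxe_pMr// mule0.
Qed.

End density.

(** * Exponential moments on the product space: integrals of products over coordinates *)

Section product.
Context d (X : measurableType d) (R : realType).
Variables (P : probability X R) (PP : probability (sequence_space X) R).
Hypothesis prodP : infinite_product P PP.

Lemma measurable_coordinate n :
  measurable_fun [set: sequence_space X] (fun w : sequence_space X => w n).
Proof.
move=> _ B mB; apply: sub_sigma_algebra.
by exists n => //; exists B.
Qed.

Lemma measurable_prod_coordinates (f : X -> R) n :
  measurable_fun [set: X] f ->
  measurable_fun [set: sequence_space X]
    (fun w : sequence_space X => \prod_(i < n) f (w i))%R.
Proof.
move=> mf; apply: measurable_prod => i _; apply: measurableT_comp => //.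
exact: measurable_coordinate.
Qed.

Lemma measurable_rectangle k n (A : nat -> set X) :
  (forall i, measurable (A i)) ->
  measurable [set w : sequence_space X |
    forall i, (i < n)%N -> A i (w (k + i)%N)].
Proof.
move=> mA; rewrite [X in measurable X](_ : _ = \bigcap_(i in `I_n)
  (fun w : sequence_space X => w (k + i)%N) @^-1` A i); last first.
  by apply/seteqP; split => w /=.
apply: bigcap_measurableType => i _; rewrite -[X in measurable X]setTI.
exact: measurable_coordinate.
Qed.

(** The claim is strengthened for the induction: the first k coordinates carry the factor [f] while
    the next ones are confined to a rectangle. For k = 0 this is the specification of [PP]. In the
    inductive step the law of coordinate k, weighted by the factors before it and the rectangle
    after it, is a multiple of [P], so the new factor integrates to [m]. *)
Lemma integral_prod_coordinates (f : X -> R) (m : R) n :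
    measurable_fun [set: X] f -> (forall x, 0 <= f x)%R ->
    \int[P]_x (f x)%:E = m%:E ->
  \int[PP]_w (\prod_(i < n) f (w i))%:E = (m ^+ n)%:E.
Proof.
move=> mf f0 fm.
have m0 : (0 <= m)%R.
  by rewrite -lee_fin -fm; apply: integral_ge0 => x _; rewrite lee_fin.
suff H k : forall n (A : nat -> set X), (forall i, measurable (A i)) ->
    \int[PP]_(w in [set w : sequence_space X |
        forall i, (i < n)%N -> A i (w (k + i)%N)])
      (\prod_(i < k) f (w i))%:E = (m ^+ k)%:E * \prod_(i < n) P (A i).
  have := H n 0%N (fun=> setT) (fun=> measurableT).
  rewrite big_ord0 mule1 => <-; congr (integral _ _ _).
  by apply/seteqP; split.
elim: k => [|k ih] k' A mA.
  under eq_integral do rewrite big_ord0.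
  rewrite integral_cst; last exact: measurable_rectangle.
  by rewrite expr0 !mul1e; exact: prodP.
set D := [set w : sequence_space X | _].
have mD : measurable D by exact: measurable_rectangle.
pose C := (m ^+ k * fine (\prod_(i < k') P (A i)))%R.
have PA : \prod_(i < k') P (A i) \is a fin_num.
  by apply: prode_fin_num => i _; exact: fin_num_measure.
have C0 : (0 <= C)%R.
  by rewrite mulr_ge0 ?exprn_ge0// fine_ge0// prode_ge0// => i _.
pose nu := mscale (NngNum C0) P.
pose h (w : sequence_space X) := ((\prod_(i < k) f (w i)) * \1_D w)%R.
have mh : measurable_fun setT h.
  apply: measurable_funM; last exact: measurable_indic.
  exact: measurable_prod_coordinates.
have h0 w : (0 <= h w)%R by rewrite mulr_ge0 ?prodr_ge0.
have nuE B : measurable B ->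
    nu B = \int[PP]_(w in (fun w : sequence_space X => w k) @^-1` B) (h w)%:E.
  (* Prepending [B] to the sets [A] merges the condition on coordinate k and those on the later
     coordinates into one rectangle starting at k. *)
  move=> mB; have := ih k'.+1 (fun i => if i is j.+1 then A j else B).
  rewrite big_ord_recl/= => ihB; rewrite /nu /mscale/= /C EFinM fineK//.
  rewrite -muleA [_ * P B]muleC -ihB; last by case.
  rewrite [LHS]integral_mkcond [RHS]integral_mkcond.
  apply: eq_integral => w _; rewrite !patchE /h indicE.
  rewrite (_ : (w \in [set _ | _]) =
    (w \in (fun w : sequence_space X => w k) @^-1` B) && (w \in D)).
    by case: (w \in _ @^-1` B) => /=; case: (w \in D); rewrite ?mulr1 ?mulr0.
  apply/idP/andP; rewrite !inE/=.
    move=> H; split; first by have := H 0%N isT; rewrite addn0.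
    by move=> i ik; have := H i.+1 ik; rewrite addnS addSn.
  by move=> [wB wD] [|i] ik; rewrite ?addn0// addnS -addSn; exact: wD.
have -> : (m ^+ k.+1)%:E * \prod_(i < k') P (A i) = C%:E * m%:E.
  by rewrite -(fineK PA) -!EFinM exprSr mulrAC.
rewrite -fm.
have := @ge0_integral_mscale _ _ R P _ measurableT (NngNum C0) (EFin \o f).
move=> <-//; last 2 first.
- exact/measurable_EFinP.
- by move=> x _; rewrite lee_fin.
rewrite (@ge0_integral_density _ _ _ _ _ PP nu (fun w => w k) h
  (measurable_coordinate k) mh h0 nuE (EFin \o f)); last 2 first.
- exact/measurable_EFinP.
- by move=> x; rewrite lee_fin.
rewrite [LHS]integral_mkcond; apply: eq_integral => w _.
rewrite patchE -EFinM /h indicE.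
by case: ifPn => wD; rewrite ?mulr1 ?mulr0// big_ord_recr mulrC.
Qed.

End product.

(** * Differentiation of exponential moments under the integral sign *)

Section exponential_moments.
Context d (T : measurableType d) (R : realType).
Variables (mu : {measure set T -> \bar R}) (D : set T) (V : T -> R).
Hypothesis mD : measurable D.
Hypothesis mV : measurable_fun [set: T] V.

Lemma measurable_expR_mul u : measurable_fun [set: T] (fun x => expR (u * V x)%R).
Proof. by apply: measurableT_comp => //; exact: measurable_funM. Qed.

Section derivative.
Variables (u e : R).
Hypothesis e0 : (0 < e)%R.
Hypothesis intD : mu.-integrable D (fun x => (expR ((u + e) * V x))%:E).
Hypothesis intB : mu.-integrable D (fun x => (expR ((u - e) * V x))%:E).

Let G x := (expR ((u + e) * V x) + expR ((u - e) * V x))%R.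

Let intG : mu.-integrable D (EFin \o G).
Proof. by rewrite /comp/G; under eq_fun do rewrite EFinD; exact: integrableD. Qed.

Let I : set R := `](u - e / 2)%R, (u + e / 2)%R[.

Let Iu : I u.
Proof. by rewrite /I/= in_itv/= gtrBl ltrDl divr_gt0. Qed.

Let expR_le v x : I v -> (expR (v * V x) <= G x)%R.
Proof.
rewrite /I/= in_itv/= => /andP[uv vu]; rewrite /G.
have [V0|V0] := leP 0%R (V x).
  rewrite -[leLHS]addr0 lerD ?expR_ge0// ler_expR ler_wpM2r//; have := e0; lra.
rewrite -[leLHS]add0r lerD ?expR_ge0// ler_expR ler_nM2r//; have := e0; lra.
Qed.

(** The factor [V x] is absorbed by y <= (2 / e) exp (e y / 2), which spends half of the margin [e];
    this is why [I] has radius e / 2. The bound is uniform in [v], as dominated differentiation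
    requires. *)
Let mul_expR_le v x : I v -> (`|V x * expR (v * V x)| <= (2 / e) * G x)%R.
Proof.
rewrite /I/= in_itv/= => /andP[uv vu]; rewrite /G normrM (ger0_norm (expR_ge0 _)).
have H (y : R) : (y <= 2 / e * expR (e / 2 * y))%R.
  rewrite -ler_pdivrMl ?divr_gt0// invf_div.
  by rewrite (le_trans _ (expR_ge1Dx _))// ler_wpDl.
have [V0|V0] := leP 0%R (V x).
  rewrite ger0_norm// (@le_trans _ _ (2 / e * expR ((u + e) * V x))%R)//; last first.
    by rewrite ler_pM2l ?divr_gt0// lerDl expR_ge0.
  rewrite (le_trans (ler_wpM2r (expR_ge0 _) (H _)))//.
  rewrite -(mulrA (2 / e)%R) -expRD ler_pM2l ?divr_gt0// ler_expR.
  by rewrite -mulrDl ler_wpM2r//; have := e0; lra.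
rewrite ltr0_norm// (@le_trans _ _ (2 / e * expR ((u - e) * V x))%R)//; last first.
  by rewrite ler_pM2l ?divr_gt0// lerDr expR_ge0.
rewrite (le_trans (ler_wpM2r (expR_ge0 _) (H _)))//.
rewrite -(mulrA (2 / e)%R) -expRD ler_pM2l ?divr_gt0// ler_expR.
by rewrite mulrN -mulNr -mulrDl ler_nM2r//; have := e0; lra.
Qed.

Lemma integrable_mul_expR_mul :
  mu.-integrable D (fun x => (V x * expR (u * V x))%:E).
Proof.
have : mu.-integrable D (fun x => (2 / e)%:E * (EFin \o G) x).
  exact: integrableZl.
apply: le_integrable => //.
  apply/measurable_EFinP; apply: measurable_funTS; apply: measurable_funM => //.
  exact: measurable_expR_mul.
move=> x Dx; rewrite lee_fin (le_trans (mul_expR_le _ Iu))//.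
exact: ler_norm.
Qed.

Let derx (x v : R) :
  is_derive v (1%R : R) (fun w : R => expR (w * x)) (x * expR (v * x))%R.
Proof.
have -> : (fun w : R => expR (w * x)) = expR \o (x \*: @id R)%R.
  by apply/funext => w /=; rewrite mulrC.
rewrite mulrC mulrC [(v * x)%R]mulrC mulrC.
apply: is_derive1_comp.
by have := is_deriveZ x (is_derive_id v (1%R : R)); rewrite /GRing.scale/= mulr1.
Qed.

Lemma is_derive_integral_expR :
  is_derive u (1%R : R) (fun v => \int[mu]_(x in D) expR (v * V x))%R
    (\int[mu]_(x in D) (V x * expR (u * V x)))%R.
Proof.
have d1E v x : partial1of2 (fun v x => expR (v * V x)) v x = (V x * expR (v * V x))%R.
  rewrite partial1of2E; by case: (derx (V x) v).
have intf v : I v -> mu.-integrable D (EFin \o (fun x => expR (v * V x))%R).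
  move=> Iv; apply: (le_integrable mD _ _ intG).
    by apply/measurable_EFinP/measurable_funTS; exact: measurable_expR_mul.
  move=> x Dx; rewrite /comp lee_fin ger0_norm ?expR_ge0//.
  by rewrite (le_trans _ (ler_norm _))// expR_le.
have derf v x : I v -> D x -> derivable (fun w : R => expR (w * V x))%R v (1%R : R).
  by move=> _ _; case: (derx (V x) v).
have G0 x : (0 <= 2 / e * G x)%R by rewrite mulr_ge0 ?divr_ge0 ?addr_ge0 ?expR_ge0// ltW.
have intG' : mu.-integrable D (EFin \o (fun x => 2 / e * G x)%R).
  by rewrite /comp; under eq_fun do rewrite EFinM; exact: integrableZl.
have G_ub v x : I v -> D x ->
    (`|partial1of2 (fun v x => expR (v * V x)) v x| <= 2 / e * G x)%R.
  by move=> Iv _; rewrite d1E; exact: mul_expR_le.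
apply: DeriveDef.
  exact: (derivable_under_integral mD Iu intf derf G0 intG' G_ub).
rewrite -derive1E (differentiation_under_integral mD Iu intf derf G0 intG' G_ub).
by apply: eq_Rintegral => x _; rewrite d1E.
Qed.

End derivative.
End exponential_moments.

(* Locked because unification otherwise unfolds it at great expense. *)
HB.lock Definition truncated_moment d (X : measurableType d) (R : realType)
    (P : probability X R) (V : X -> R) (n : nat) (u : R) : R :=
  (\int[P]_(x in [set x | `|V x| <= n%:R]) expR (u * V x))%R.

(** One step [h] serves both directions. Applied to a truncated moment with b = kap * f v, it makes
    the growth of the moment lose against exp (h kap) >= 1 + h kap. *)
Lemma is_derive0_lt (R : realType) (f : R -> R) (v b : R) :
    is_derive v (1%R : R) f 0%R -> (0 < b)%R ->
  exists2 h : R, (0 < h)%R &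
    (f (v + h) < f v + b * h)%R /\ (f (v - h) < f v + b * h)%R.
Proof.
move=> [/cvg_ex[/= l fl] f0] b0.
have l0 : l = 0%R by rewrite -f0; apply/esym/cvg_lim.
move: fl; rewrite l0 => /cvgrPdist_lt/(_ _ b0)[e /= e0 fe].
have fh h : h != 0%R -> (`|h| < e)%R -> (f (v + h) < f v + b * `|h|)%R.
  move=> h0 he; have := fe h; rewrite /= sub0r normrN => /(_ he h0).
  rewrite scaler1 sub0r normrN addrC normrZ normfV.
  rewrite ltr_pdivrMl ?normr_gt0// mulrC => /(le_lt_trans (ler_norm _)).
  by rewrite addrC ltrBlDl [(h + v)%R]addrC.
exists (e / 2)%R; first by rewrite divr_gt0.
have ge0 : (0 < e / 2)%R by rewrite divr_gt0.
have ee : (e / 2 < e)%R by rewrite ltr_pdivrMr// ltr_pMr// ltr1n.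
split; first by have := fh (e / 2)%R; rewrite gtr0_norm ?gt_eqF//; exact.
have := fh (- (e / 2))%R; rewrite normrN gtr0_norm// oppr_eq0 gt_eqF//; exact.
Qed.

(** * Chernoff's upper bound and Cramer's lower bound for sums of i.i.d. real variables *)

Section deviations.
Context d (X : measurableType d) (R : realType).
Variables (P : probability X R) (PP : probability (sequence_space X) R).
Hypothesis prodP : infinite_product P PP.
Variable V : X -> R.
Hypothesis mV : measurable_fun [set: X] V.

Lemma measurable_sum_coordinates n :
  measurable_fun [set: sequence_space X]
    (fun w : sequence_space X => \sum_(i < n) V (w i))%R.
Proof.
apply: measurable_sum => i; apply: measurableT_comp => //.
exact: measurable_coordinate.
Qed.

Lemma measurable_sum_le n a :
  measurable [set w : sequence_space X | (\sum_(i < n) V (w i) <= a)%R].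
Proof.
rewrite -[X in measurable X]setTI; apply: measurable_fun_le => //.
exact: measurable_sum_coordinates.
Qed.

Lemma measurable_norm_sum_le n a :
  measurable [set w : sequence_space X | (`|\sum_(i < n) V (w i)| <= a)%R].
Proof.
rewrite -[X in measurable X]setTI; apply: measurable_fun_le => //.
by apply: measurableT_comp => //; exact: measurable_sum_coordinates.
Qed.

Lemma chernoff_bound n (s a m : R) : (0 <= s)%R ->
    \int[P]_x (expR (- s * V x))%:E = m%:E ->
  PP [set w : sequence_space X | (\sum_(i < n) V (w i) <= a)%R] <=
  (expR (s * a) * m ^+ n)%:E.
Proof.
move=> s0 mE; set A := [set w | _].
have mA : measurable A by exact: measurable_sum_le.
have mf : measurable_fun setT (fun x => expR (- s * V x)).
  exact: measurable_expR_mul.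
rewrite -[PP A]mul1e -integral_cst// EFinM.
rewrite -(integral_prod_coordinates prodP n mf _ mE)//.
rewrite -ge0_integralZl//=; last 2 first.
- by apply/measurable_EFinP; exact: (measurable_prod_coordinates n mf).
- by move=> w _; rewrite lee_fin prodr_ge0// => i _; exact: expR_ge0.
rewrite integral_mkcond; apply: ge0_le_integral => //.
- by move=> w _; rewrite patchE; case: ifPn.
- by rewrite -measurable_restrictT//; exact: measurable_cst.
- apply: emeasurable_funM => //.
  by apply/measurable_EFinP; exact: (measurable_prod_coordinates n mf).
move=> w _; rewrite patchE -EFinM -expR_sum -expRD -mulr_sumr mulNr -mulrBr.
case: ifPn => [|_]; last by rewrite lee_fin expR_ge0.
rewrite inE /A/= => Sa; rewrite lee_fin -expR0 ler_expR mulr_ge0//.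
by rewrite subr_ge0.
Qed.

Let D n := [set x | (`|V x| <= n%:R)%R].

Let mD n : measurable (D n).
Proof.
rewrite -[X in measurable X]setTI; apply: measurable_fun_le => //.
exact: measurableT_comp.
Qed.

Let intD n u : P.-integrable (D n) (fun x => (expR (u * V x))%:E).
Proof.
apply: (@le_integrable _ _ _ P _ (mD n) _ (fun=> (expR (`|u| * n%:R))%:E)).
- by apply/measurable_EFinP/measurable_funTS; exact: measurable_expR_mul.
- move=> x Dx; rewrite lee_fin !(ger0_norm (expR_ge0 _)) ler_expR.
  by rewrite (le_trans (ler_norm _))// normrM ler_wpM2l.
- exact: finite_measure_integrable_cst.
Qed.

Local Notation G := (truncated_moment P V).

Let GE n u : (G n u)%:E = \int[P]_(x in D n) (expR (u * V x))%:E.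
Proof.
rewrite truncated_moment.unlock /Rintegral fineK//.
by have := integrable_fin_num (mD n) (intD n u).
Qed.

Let G_derive n u : is_derive u (1%R : R) (G n)
  (\int[P]_(x in D n) (V x * expR (u * V x)))%R.
Proof.
rewrite (_ : G n = fun v => (\int[P]_(x in D n) expR (v * V x))%R).
  exact: (@is_derive_integral_expR _ _ _ P (D n) V (mD n) mV u 1%R).
by apply/funext => v; rewrite truncated_moment.unlock.
Qed.

Let G_cont n : continuous (G n).
Proof.
move=> u; apply/differentiable_continuous/derivable1_diffP.
by case: (G_derive n u).
Qed.

Let G_nd n k u : (n <= k)%N -> (G n u <= G k u)%R.
Proof.
move=> nk; rewrite -lee_fin !GE; apply: ge0_subset_integral => //.
- by apply/measurable_EFinP/measurable_funTS; exact: measurable_expR_mul.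
- by move=> x /le_trans; apply; rewrite ler_nat.
Qed.

Let G_gt (a u : R) : a%:E < \int[P]_x (expR (u * V x))%:E ->
  exists n, (a < G n u)%R.
Proof.
move=> aM.
have : \int[P]_(x in D n) (expR (u * V x))%:E @[n --> \oo] -->
    \int[P]_(x in \bigcup_n D n) (expR (u * V x))%:E.
  apply: ge0_nondecreasing_set_cvg_integral => //.
  - move=> n k nk; apply/subsetPset => x /le_trans; apply.
    by rewrite ler_nat.
  - by move=> n; apply/measurable_EFinP/measurable_funTS; exact: measurable_expR_mul.
have -> : \bigcup_n D n = setT.
  apply/seteqP; split => // x _; exists (Num.truncn `|V x|).+1 => //=.
  exact/ltW/truncnS_gt.
move=> cvgG; apply: contrapT => /forallNP Ga; move: aM.
rewrite -(cvg_lim _ cvgG)// ltNge => /negP; apply.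
apply: lime_le; first by apply/cvg_ex; eexists; exact: cvgG.
apply: nearW => n; rewrite -GE lee_fin leNgt; exact/negP.
Qed.

(* Dini: the truncated moments increase to a limit exceeding [a] pointwise on a
   compact interval, hence one of them exceeds [a] uniformly. *)
Let G_gt_compact (a B : R) :
    (forall u, (- B <= u <= B)%R -> a%:E < \int[P]_x (expR (u * V x))%:E) ->
  \forall n \near \oo, forall u, (- B <= u <= B)%R -> (a < G n u)%R.
Proof.
move=> aM.
have /compact_near_coveringP H := @segment_compact R (- B)%R B.
have : \forall n \near \oo, `[(- B)%R, B] `<=` (fun u => a < G n u)%R.
  apply: H => u /=; rewrite in_itv/= => /aM/G_gt[n an].
  have : \forall u' \near u, (a < G n u')%R.
    by apply: (@cvgr_gt _ _ (nbhs u) _ (G n) (G n u)) => //; exact: G_cont.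
  move=> nu; exists ([set u' | (a < G n u')%R], [set k | (n <= k)%N]) => /=.
    by split => //; exists n.
  by move=> [u' k] /= [au' nk]; rewrite (lt_le_trans au')// G_nd.
by apply: filterS => n H' u uB; apply: H' => /=; rewrite in_itv.
Qed.

Let intG n u (f := fun x => (expR (u * V x) * \1_(D n) x)%R) k :
  \int[PP]_w (\prod_(i < k) f (w i))%:E = (G n u ^+ k)%:E.
Proof.
apply: (integral_prod_coordinates prodP).
- apply: measurable_funM; first exact: measurable_expR_mul.
  exact: measurable_indic.
- by move=> x; rewrite mulr_ge0 ?expR_ge0.
- rewrite GE [RHS]integral_mkcond; apply: eq_integral => x _.
  by rewrite patchE /f indicE; case: ifPn; rewrite ?mulr1 ?mulr0.
Qed.

(** Integrated form of a pointwise inequality for exp (v S), where S is the sum. Inside the window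
    it is at most exp (B kap k). Outside, |S| > kap k, so moving the tilt by [h] in the direction of
    the sign of S multiplies it by at least exp (h kap k), which the factor exp (- (h kap)) per
    coordinate compensates. *)
Let window_bound n k (v h kap B : R) : (`|v| <= B)%R -> (0 <= h)%R ->
  (0 <= kap)%R ->
  (G n v ^+ k)%:E <=
    (expR (B * kap * k%:R))%:E *
      PP [set w : sequence_space X | (`|\sum_(i < k) V (w i)| <= kap * k%:R)%R] +
    ((expR (- (h * kap)) * G n (v + h)) ^+ k +
     (expR (- (h * kap)) * G n (v - h)) ^+ k)%:E.
Proof.
move=> vB h0 kap0; set W := [set w | _].
have mW : measurable W by exact: measurable_norm_sum_le.
pose f u x := (expR (u * V x) * \1_(D n) x)%R.
have mf u : measurable_fun [set: X] (f u).
  apply: measurable_funM; first exact: measurable_expR_mul.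
  exact: measurable_indic.
have mF u : measurable_fun [set: sequence_space X]
    (fun w : sequence_space X => (\prod_(i < k) f u (w i))%:E).
  by apply/measurable_EFinP; exact: measurable_prod_coordinates.
have f0 u (w : sequence_space X) : (0 <= \prod_(i < k) f u (w i))%R.
  by rewrite prodr_ge0// => i _; rewrite mulr_ge0 ?expR_ge0.
have e0 (y : R) : 0 <= (expR y)%:E by rewrite lee_fin expR_ge0.
have mc (c : R) u : measurable_fun [set: sequence_space X]
    (fun w : sequence_space X => c%:E * (\prod_(i < k) f u (w i))%:E).
  by apply: emeasurable_funM; [exact: measurable_cst|exact: mF].
have c0 (c : R) u (w : sequence_space X) : (0 <= c)%R ->
    0 <= c%:E * (\prod_(i < k) f u (w i))%:E.
  by move=> ?; rewrite mule_ge0// lee_fin; exact: f0.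
have hk0 : (0 <= expR (- (h * kap)) ^+ k)%R by rewrite exprn_ge0 ?expR_ge0.
rewrite !exprMn EFinD !EFinM -!intG.
rewrite -[PP W]mul1e -integral_cst//.
rewrite -!ge0_integralZl//=;
  [|exact: mF|by move=> ? _; exact: f0|exact: mF|by move=> ? _; exact: f0].
rewrite [X in _ <= X + _]integral_mkcond.
rewrite -ge0_integralD//;
  [|by move=> w _; exact: c0|exact: mc|by move=> w _; exact: c0|exact: mc].
have cW0 (w : sequence_space X) :
    0 <= ((fun=> (expR (B * kap * k%:R))%:E * 1) \_ W) w.
  by rewrite patchE; case: ifPn => // _; rewrite mule1.
have mcW : measurable_fun [set: sequence_space X]
    ((fun=> (expR (B * kap * k%:R))%:E * 1) \_ W).
  by rewrite -measurable_restrictT//; exact: measurable_cst.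
rewrite -ge0_integralD//; last 2 first.
- by move=> w _; rewrite adde_ge0//; exact: c0.
- by apply: emeasurable_funD; exact: mc.
apply: ge0_le_integral => //.
- by move=> w _; exact: f0.
- exact: mF.
- by apply: emeasurable_funD => //; apply: emeasurable_funD; exact: mc.
(* [J] indicates that all k coordinates lie in the truncation set. It is the same for every tilt, so
   only exponentials of the sum remain to be compared. *)
move=> w _; have [J [J0 J1 fE]] : exists J : R, [/\ (0 <= J)%R, (J <= 1)%R &
    forall u, (\prod_(i < k) f u (w i) = expR (u * \sum_(i < k) V (w i)) * J)%R].
  exists (\prod_(i < k) \1_(D n) (w i))%R; split.
  - by rewrite prodr_ge0.
  - apply: prodr_ile1 => i _; rewrite /= indicE; case: (_ \in _) => /=; lra.
  - by move=> u; rewrite big_split/= -expR_sum mulr_sumr.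
rewrite -!/(f _ _) !fE patchE; set S := (\sum_(i < k) V (w i))%R.
have e1 (y z : R) : (y <= z)%R -> (expR y * J <= expR z * J)%R.
  by move=> yz; rewrite ler_wpM2r// ler_expR.
rewrite -expRM_natr -!EFinM -EFinD !mulrA -!expRD.
have k0 : (0 <= kap * k%:R)%R by rewrite mulr_ge0.
case: ifPn => [|/negP]; rewrite inE /W/= -/S => HS.
  rewrite mulr1 -EFinD lee_fin (@le_trans _ _ (expR (B * kap * k%:R)))//.
    rewrite (@le_trans _ _ (expR (v * S)))//; first by rewrite ler_piMr ?expR_ge0.
    rewrite ler_expR (le_trans (ler_norm _))// normrM -mulrA.
    by rewrite ler_pM.
  by rewrite lerDl addr_ge0// mulr_ge0 ?expR_ge0.
rewrite add0e lee_fin.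
have [S0|S0] := leP 0%R S.
  rewrite -[leLHS]addr0 lerD// ?mulr_ge0 ?expR_ge0//; apply: e1.
  have : (kap * k%:R <= S)%R by rewrite ltW// -(ger0_norm S0) ltNge; exact/negP.
  by move=> /(ler_wpM2l h0); lra.
rewrite -[leLHS]add0r lerD// ?mulr_ge0 ?expR_ge0//; apply: e1.
have : (kap * k%:R <= - S)%R by rewrite ltW// -(ltr0_norm S0) ltNge; exact/negP.
by move=> /(ler_wpM2l h0); lra.
Qed.

Let G_ge0 n v : (0 <= G n v)%R.
Proof. by rewrite -lee_fin GE; apply: integral_ge0 => x _; rewrite lee_fin expR_ge0. Qed.

Let G0_le1 n : (G n 0 <= 1)%R.
Proof.
rewrite -lee_fin GE; under eq_integral do rewrite mul0r expR0.
by rewrite integral_cst// mul1e probability_le1.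
Qed.

(** At tilt 0 the truncated moment is the mass of the truncation set, at most 1, so a minimum over
    [- B, B] is not attained at an endpoint. *)
Let interior_minimum n (B : R) : (0 < B)%R -> (1 < G n B)%R ->
  (1 < G n (- B))%R ->
  exists2 v : R, (`|v| <= B)%R & is_derive v (1%R : R) (G n) 0%R.
Proof.
move=> B0 GB GNB.
have NBB : (- B <= B)%R by lra.
have [|v] := @EVT_min R (G n) (- B)%R B NBB.
  by apply: continuous_subspaceT => u; exact: G_cont.
rewrite in_itv/= => /andP[Bv vB] vmin.
have Gv1 : (G n v <= 1)%R.
  rewrite (le_trans _ (G0_le1 n))// vmin// in_itv/=.
  by apply/andP; split; lra.
have Bv' : (- B < v)%R.
  rewrite lt_neqAle Bv andbT; apply/eqP => vE.
  by move: Gv1; rewrite -vE leNgt GNB.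
have vB' : (v < B)%R.
  rewrite lt_neqAle vB andbT; apply/eqP => vE.
  by move: Gv1; rewrite vE leNgt GB.
exists v; first by rewrite ler_norml Bv vB.
apply: (@derive1_at_min _ _ (- B)%R B) => //.
- by move=> t _; case: (G_derive n t).
- by rewrite in_itv/= Bv' vB'.
- by move=> t tB; apply: vmin; apply: subset_itv_oo_cc.
Qed.

(* Tilting by the critical point [v] centres the truncated law, which a further
   tilt by [+h] or [-h] shows to concentrate on the window exponentially fast. *)
Lemma deviation_lower_bound (A B kap e : R) : (0 < B)%R -> (0 < kap)%R -> (0 < e)%R ->
    (forall u, (- B <= u <= B)%R ->
      (expR (- A))%:E <= \int[P]_x (expR (u * V x))%:E) ->
    1 < \int[P]_x (expR (B * V x))%:E ->
    1 < \int[P]_x (expR (- B * V x))%:E ->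
  \forall n \near \oo, (expR (- (A + e) * n%:R))%:E <=
    PP [set w : sequence_space X | (`|\sum_(i < n) V (w i)| <= kap * n%:R)%R].
Proof.
have half_le (g y z a b : R) : (g <= y + (a + b))%R -> (a <= 4^-1 * g)%R ->
    (b <= 4^-1 * g)%R -> (y <= z)%R -> (2^-1 * g <= z)%R.
  by lra.
have sqr_le (x : R) : (0 < x)%R -> (x < 2^-1)%R -> (x * x <= 2^-1)%R by nra.
move=> B0 kap0 e0 MA MB MNB.
(* The window is narrowed so that its factor exp (B kap' k) costs at most e / 4 in the rate;
   enlarging it back to [kap] only increases the probability. *)
pose kap' := Order.min kap (e / 4 / B)%R.
have kap'0 : (0 < kap')%R by rewrite lt_min kap0 !divr_gt0.
have Bkap' : (B * kap' <= e / 4)%R.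
  by rewrite -ler_pdivlMl// mulrC ge_min lexx orbT.
have : \forall n \near \oo, forall u, (- B <= u <= B)%R ->
    (expR (- (A + e / 4)) < G n u)%R.
  apply: G_gt_compact => u uB; apply: lt_le_trans (MA u uB).
  by rewrite lte_fin ltr_expR ltrN2 ltrDl divr_gt0.
have [n1 n1B] := G_gt MB; have [n2 n2B] := G_gt MNB.
move=> [n0 _ /(_ (n0 + n1 + n2)%N)]; set n := (n0 + n1 + n2)%N => /= GA.
have {}GA : forall u, (- B <= u <= B)%R -> (expR (- (A + e / 4)) < G n u)%R.
  by apply: GA => /=; rewrite /n -addnA leq_addr.
have GB : (1 < G n B)%R.
  by rewrite (lt_le_trans n1B)// G_nd// /n addnAC leq_addl.
have GNB : (1 < G n (- B))%R by rewrite (lt_le_trans n2B)// G_nd// /n leq_addl.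
have [v vB dv] := interior_minimum B0 GB GNB.
have Av := GA v; rewrite -ler_norml in Av; have {}Av := Av vB.
have g0 : (0 < G n v)%R by rewrite (lt_trans (expR_gt0 _) Av).
have [h h0 [hD hB]] := is_derive0_lt dv (mulr_gt0 kap'0 g0).
(* Ratio of the larger term from outside the window to the main term, per coordinate. It is below 1
   because [v] is critical, so for large k each outside term is at most a quarter of the main
   one. *)
pose q := (Num.max (expR (- (h * kap')) * G n (v + h))
                   (expR (- (h * kap')) * G n (v - h)) / G n v)%R.
have q0 : (0 <= q)%R by rewrite divr_ge0// le_max mulr_ge0 ?expR_ge0.
have q1 : (q < 1)%R.
  have H : (G n v + kap' * G n v * h <= G n v * expR (h * kap'))%R.
    rewrite -[X in (X + _)%R]mulr1 -[(kap' * _)%R]mulrC -mulrA -mulrDr.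
    by rewrite ler_pM2l// [(kap' * h)%R]mulrC expR_ge1Dx.
  rewrite ltr_pdivrMr// mul1r gt_max expRN !ltr_pdivrMl ?expR_gt0//.
  by rewrite ![(expR _ * _)%R]mulrC (lt_le_trans hD)// (lt_le_trans hB).
have q_cvg : \forall k \near \oo, (q ^+ k < 4^-1)%R.
  by apply: (@cvgr_lt _ _ _ _ _ 0%R) => //; apply: cvg_expr; rewrite ger0_norm.
have e_cvg : \forall k \near \oo, (expR (- (e / 4)) ^+ k < 2^-1)%R.
  apply: (@cvgr_lt _ _ _ _ _ 0%R) => //; apply: cvg_expr.
  by rewrite ger0_norm ?expR_ge0// expR_lt1 oppr_lt0 divr_gt0.
near=> k.
have : (q ^+ k < 4^-1)%R by near: k.
have : (expR (- (e / 4)) ^+ k < 2^-1)%R by near: k.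
move=> ek qk.
have := window_bound n k vB (ltW h0) (ltW kap'0).
set W' := [set w | _]; set W := [set w | _].
have mW' : measurable W' by exact: measurable_norm_sum_le.
have mW : measurable W by exact: measurable_norm_sum_le.
have W'W : PP W' <= PP W.
  apply: le_measure; rewrite ?inE// => w /le_trans; apply.
  by rewrite ler_wpM2r// ge_min lexx.
move=> wb; apply: le_trans W'W.
have PW' : PP W' \is a fin_num by exact: fin_num_measure.
move: wb; rewrite -(fineK PW') -EFinM -EFinD !lee_fin; set p := fine (PP W').
move=> wb.
set x := (expR (- (e / 4)) ^+ k)%R in ek.
have x0 : (0 < x)%R by rewrite exprn_gt0 ?expR_gt0.
have p0 : (0 <= p)%R by rewrite fine_ge0.
set g := (G n v ^+ k)%R in wb.
have qg (z : R) : (0 <= z)%R ->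
    (z <= Num.max (expR (- (h * kap')) * G n (v + h))
                  (expR (- (h * kap')) * G n (v - h)))%R -> (z ^+ k <= 4^-1 * g)%R.
  move=> z0 zm; rewrite (@le_trans _ _ ((q * G n v) ^+ k))%R//.
    rewrite lerXn2r ?nnegrE//; first by rewrite mulr_ge0// ltW.
    by rewrite /q divfK ?gt_eqF.
  by rewrite exprMn ler_wpM2r ?exprn_ge0// ltW.
have ag : (expR (- (A + e / 4) * k%:R) <= g)%R.
  by rewrite expRM_natr lerXn2r ?nnegrE ?expR_ge0// ltW.
have gp : (2^-1 * g <= x^-1 * p)%R.
  have q1g : ((expR (- (h * kap')) * G n (v + h)) ^+ k <= 4^-1 * g)%R.
    by rewrite qg// ?mulr_ge0 ?expR_ge0// le_max lexx.
  have q2g : ((expR (- (h * kap')) * G n (v - h)) ^+ k <= 4^-1 * g)%R.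
    by rewrite qg// ?mulr_ge0 ?expR_ge0// le_max lexx orbT.
  have : (expR (B * kap' * k%:R) * p <= x^-1 * p)%R.
    rewrite ler_wpM2r// /x -exprVn -expRN opprK -expRM_natr ler_expR.
    by rewrite ler_wpM2r.
  exact: half_le wb q1g q2g.
(* Budget for [e]: one quarter went into truncation, one [x] pays for the window factor, and the
   other two absorb the constant 1/2. *)
have -> : (expR (- (A + e) * k%:R) = expR (- (A + e / 4) * k%:R) * x * x * x)%R.
  by rewrite /x -expRM_natr -!expRD; congr expR; field.
have xg : (2^-1 * g * x <= p)%R.
  by rewrite -ler_pdivlMr// [leRHS]mulrC.
rewrite (le_trans _ xg)//.
have x1 := sqr_le x x0 ek.
rewrite ler_wpM2r ?(ltW x0)// -mulrA [leRHS]mulrC.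
by rewrite ler_pM ?expR_ge0// mulr_ge0 ?ltW.
Unshelve. all: by end_near.
Qed.

End deviations.

Lemma probability_setI1 d (T : measurableType d) (R : realType)
    (P : probability T R) (A B : set T) :
  measurable A -> measurable B -> P B = 1 -> P A = P (A `&` B).
Proof.
move=> mA mB PB.
have PBC : P (~` B) = 0 by rewrite probability_setC// PB subee.
rewrite -(setUIDK A B) measureU//; last 3 first.
- exact: measurableI.
- exact: measurableD.
- by rewrite setIACA setICr setI0.
rewrite setUIDK [X in _ + X](_ : _ = 0) ?adde0//.
apply: subset_measure0 PBC; [exact: measurableD|exact: measurableC|].
by move=> x [].
Qed.

(** * The logarithm of the e-variable as a real random variable, and its moments *)

Section log_evariable.
Context d (X : measurableType d) (R : realType) (P0 P1 : probability X R).
Variable E : evariable P0.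
Hypothesis intE : P1.-integrable [set: X] (fun x => lne (E x)).

(** [fine] puts 0 where E is 0 or +oo, a null set under [P1] once log E is integrable. *)
Definition log_evar (x : X) : R := fine (lne (E x)).
Local Notation L := log_evar.
Local Notation c := (fine (mean_log P1 E)).

Lemma measurable_lne_evar : measurable_fun [set: X] (fun x => lne (E x)).
Proof. by apply: measurableT_comp; [exact: measurable_lne|exact: measurable_evar]. Qed.

Lemma measurable_log_evar : measurable_fun [set: X] L.
Proof. by apply: measurableT_comp => //; exact: measurable_lne_evar. Qed.
Local Notation mL := measurable_log_evar.

Lemma lne_evar_ae : {ae P1, forall x, lne (E x) = (L x)%:E}.
Proof.
have := integrable_ae measurableT intE; apply: filterS => x /(_ I) xfin.
by rewrite /L fineK.
Qed.

Lemma integrable_log_evar : P1.-integrable [set: X] (fun x => (L x)%:E).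
Proof.
apply: le_integrable intE => //.
  by apply/measurable_EFinP; exact: mL.
by move=> x _; rewrite /log_evar; case: (lne (E x)) => [r||] /=;
  rewrite ?normr0 ?leey ?lexx.
Qed.

Lemma mean_logE : mean_log P1 E = \int[P1]_x (L x)%:E.
Proof.
apply: ae_eq_integral => //; first exact: measurable_lne_evar.
  by apply/measurable_EFinP; exact: mL.
by apply: filterS lne_evar_ae => x ->.
Qed.

Lemma mean_log_fin_num : mean_log P1 E \is a fin_num.
Proof. by apply: integrable_fin_num. Qed.

Lemma momentE l : moment P1 E l = \int[P1]_x (expR (l * L x))%:E.
Proof.
apply: ae_eq_integral => //.
- apply: measurableT_comp; first exact: measurable_expeR.
  by apply: emeasurable_funM => //; exact: measurable_lne_evar.
- by apply/measurable_EFinP; exact: measurable_expR_mul mL _.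
- by apply: filterS lne_evar_ae => x H _; rewrite /epow H.
Qed.

(** Jensen's inequality, by integrating the tangent line of the exponential at l c. *)
Lemma moment_ge l : (expR (l * c))%:E <= moment P1 E l.
Proof.
rewrite momentE.
have [Moo|Moo] := eqVneq (\int[P1]_x (expR (l * L x))%:E) +oo.
  by rewrite Moo leey.
have mexp : measurable_fun [set: X] (fun x => (expR (l * L x))%:E).
  by apply/measurable_EFinP; exact: measurable_expR_mul mL _.
have iexp : P1.-integrable [set: X] (fun x => (expR (l * L x))%:E).
  apply/integrableP; split => //.
  under eq_integral do rewrite gee0_abs ?lee_fin ?expR_ge0//.
  by rewrite ltey.
pose a : R := expR (l * c).
have ilin : P1.-integrable [set: X] (fun x => a%:E * l%:E * (L x)%:E).
  by rewrite -EFinM; apply: integrableZl => //; exact: integrable_log_evar.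
have icst : P1.-integrable [set: X] (cst (a * (1 - l * c))%:E).
  exact: finite_measure_integrable_cst.
have -> : (expR (l * c))%:E =
    \int[P1]_x ((cst (a * (1 - l * c))%:E) x + a%:E * l%:E * (L x)%:E).
  rewrite integralD// integral_cst// -EFinM integralZl//; last first.
    exact: integrable_log_evar.
  have -> : \int[P1]_x (L x)%:E = c%:E by rewrite fineK ?mean_log_fin_num// mean_logE.
  rewrite [X in _ * X + _](_ : _ = 1) ?mule1; last exact: probability_setT.
  by rewrite -EFinM -EFinD; congr (_%:E); rewrite /a; ring.
apply: le_integral => //; first exact: integrableD.
move=> x _; rewrite -!EFinM -EFinD lee_fin.
have -> : (l * L x = l * c + l * (L x - c))%R by ring.
rewrite expRD -/a (_ : (_ + _ = a * (1 + l * (L x - c)))%R); last by ring.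
by rewrite ler_pM2l ?expR_gt0// expR_ge1Dx.
Qed.

Lemma moment_gt0 l : 0 < moment P1 E l.
Proof. by apply: lt_le_trans (moment_ge l); rewrite lte_fin expR_gt0. Qed.

Lemma moment0 : moment P1 E 0 = 1.
Proof.
rewrite momentE; under eq_integral do rewrite mul0r expR0.
by rewrite integral_cst// mul1e; exact: probability_setT.
Qed.

(** By Jensen the moment is positive, so a tilted exponent is either real or -oo, the latter for an
    infinite moment; later case distinctions rest on this. *)
Lemma tilted_exponent_lty s : tilted_exponent P1 E s < +oo.
Proof.
rewrite /tilted_exponent lteNl; have := moment_gt0 (- s).
by case: (moment P1 E (- s)) => [r||]//; rewrite lte_fin => r0; rewrite lne_EFin// ltNyr.
Qed.

Lemma acgfE s : acgf P1 E s = s%:E * mean_log P1 E - tilted_exponent P1 E s.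
Proof.
rewrite /acgf /tilted_exponent oppeK -(fineK mean_log_fin_num).
under eq_integral => x _.
  rewrite muleDr ?fin_num_adde_defl// expeRD muleC -EFinN -EFinM mulrNN.
  over.
rewrite /=.
rewrite ge0_integralZl//; last 2 first.
- apply: measurableT_comp; first exact: measurable_expeR.
  by apply: emeasurable_funM => //; exact: measurable_lne_evar.
- by move=> x _; exact: expeR_ge0.
rewrite -/(moment P1 E (- s)) lneM ?in_itv/= ?leey ?moment_gt0 ?lte_fin ?expR_gt0//.
by rewrite leNgt expR_gt0/= expRK EFinM.
Qed.

Lemma acgf_ge0 s : 0 <= acgf P1 E s.
Proof.
rewrite acgfE /tilted_exponent oppeK -(fineK mean_log_fin_num).
have : lne (expR (- s * c))%:E <= lne (moment P1 E (- s)).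
  rewrite lee_lne ?moment_ge// in_itv/= ?leey ?lee_fin ?expR_ge0//.
  by rewrite ltW// moment_gt0.
rewrite lne_EFin ?expR_gt0// expRK => /(leeD2l (s * c)%:E).
by rewrite -EFinD -EFinM mulNr subrr.
Qed.

End log_evariable.

(** * Type-II errors: reduction to sums, Chernoff bound, comparison of the two errors *)

Section type2_errors.
Context d (X : measurableType d) (R : realType) (P0 P1 : probability X R).
Variables (PP1 : probability (sequence_space X) R) (E : evariable P0).
Hypothesis prodP : infinite_product P1 PP1.
Hypothesis intE : P1.-integrable [set: X] (fun x => lne (E x)).
Local Notation L := (log_evar E).
Local Notation mL := (measurable_log_evar E).

Lemma measurable_wealth t :
  measurable_fun [set: sequence_space X] (wealth E t : sequence_space X -> \bar R).
Proof.
elim: t => [|t ih].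
  rewrite (_ : wealth E 0 = cst 1); first exact: measurable_cst.
  by apply/funext => w; rewrite /wealth big_ord0.
rewrite (_ : wealth E t.+1 = (fun w => wealth E t w * E (w t))); last first.
  by apply/funext => w; rewrite /wealth big_ord_recr.
apply: emeasurable_funM => //; apply: measurableT_comp.
  exact: measurable_evar.
exact: measurable_coordinate.
Qed.

Lemma measurable_wealth_le t (a : \bar R) :
  measurable ([set w | wealth E t w <= a] : set (sequence_space X)).
Proof.
rewrite -[X in measurable X]setTI.
by apply: emeasurable_fun_le => //; exact: measurable_wealth.
Qed.

(** The wealth is the exponential of the sum of [log_evar] only where the first t factors have a
    finite logarithm. That event is a rectangle of probability 1, and both events are intersected
    with it. *)
Lemma type2_errorE alpha t : (0 < alpha)%R ->
  type2_error E PP1 alpha t =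
  PP1 [set w : sequence_space X | (\sum_(i < t) L (w i) <= ln alpha^-1)%R].
Proof.
move=> a0; pose good := [set x | lne (E x) \is a fin_num].
have mgood : measurable good.
  rewrite -[X in measurable X]setTI; apply: emeasurable_fin_num => //.
  exact: measurable_lne_evar.
have Pgood : P1 good = 1.
  have : P1 (~` good) = 0.
    apply/negligibleP; first exact: measurableC.
    have := integrable_ae measurableT intE; apply: filterS => x; exact.
  have Pfin : P1 good \is a fin_num by exact: fin_num_measure.
  rewrite probability_setC// => /eqP; rewrite sube_eq ?fin_num_adde_defr//.
  by rewrite add0e => /eqP <-.
pose B := [set w : sequence_space X | forall i, (i < t)%N -> good (w i)].
have mB : measurable B.
  exact: (@measurable_rectangle _ X 0 t (fun=> good)).
have PB : PP1 B = 1.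
  have := prodP t (fun=> mgood); rewrite -/B => ->.
  by rewrite big1// => i _; exact: Pgood.
rewrite /type2_error (probability_setI1 (measurable_wealth_le _ _) mB PB).
rewrite [RHS](probability_setI1 (measurable_sum_le mL _ _) mB PB).
have expR_le_inv (S : R) : (expR S <= alpha^-1)%R = (S <= ln alpha^-1)%R.
  by rewrite -[RHS]ler_expR lnK// posrE invr_gt0.
congr (PP1 _); apply/seteqP; split => w /= [H wB]; split => //; move: H.
all: have -> : wealth E t w = (expR (\sum_(i < t) L (w i)))%:E.
1,3: rewrite expR_sum -prodEFin; apply: eq_bigr => i _;
  rewrite -[E (w i)]lneK ?in_itv/= ?evar_ge0 ?leey// /log_evar;
  by rewrite -[in LHS](fineK (wB i (ltn_ord i))).
all: by rewrite lee_fin expR_le_inv.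
Qed.

Lemma type2_error_le_tilt alpha t s : (0 < alpha)%R -> (0 < t)%N -> (0 <= s)%R ->
  tilt_objective P1 E t (ln alpha^-1) s <= - lne (type2_error E PP1 alpha t).
Proof.
move=> a0 t0 s0; rewrite /tilt_objective /tilted_exponent type2_errorE//.
set q := PP1 _.
have := moment_gt0 intE (- s); have := momentE intE (- s).
case: (moment P1 E (- s)) => [m||]// mE; last first.
  (* An infinite moment gives the objective the value -oo; here t > 0 enters, as 0 * -oo is 0. *)
  by rewrite /= gt0_muleNy ?lte_fin ?ltr0n// addNye leNye.
rewrite lte_fin => m0; rewrite lne_EFin// -EFinN -!EFinM -EFinN -EFinD leeNr.
have := chernoff_bound prodP mL t (ln alpha^-1) s0 (esym mE); rewrite -/q => qm.
rewrite (@le_trans _ _ (lne (expR (s * ln alpha^-1) * m ^+ t)%:E))//.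
  rewrite lee_lne// in_itv/= ?leey ?andbT ?measure_ge0//.
  by rewrite lee_fin mulr_ge0 ?expR_ge0 ?exprn_ge0// ltW.
rewrite lne_EFin; last by rewrite mulr_gt0 ?expR_gt0 ?exprn_gt0.
rewrite lnM ?posrE ?expR_gt0 ?exprn_gt0// expRK lnXn// lee_fin -mulr_natl; lra.
Qed.

Lemma type2_error_le alpha t : (0 < alpha)%R -> (0 < t)%N ->
  type2_error E PP1 alpha t <=
  expeR (- ereal_sup [set tilt_objective P1 E t (ln alpha^-1) s | s in
                        [set s : R | (0 <= s)%R]]).
Proof.
move=> a0 t0; set q := type2_error _ _ _ _.
have q0 : q \in `[0, +oo].
  by rewrite in_itv/= leey andbT /q type2_errorE// measure_ge0.
rewrite -[leLHS]lneK// lee_expeR leeNr; apply: ge_ereal_sup => _ [s /= s0 <-].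
exact: type2_error_le_tilt.
Qed.

Lemma crossing_timeP alpha t w :
  (t%:R%:E < crossing_time E alpha w) <->
  forall n, (0 < n <= t)%N -> wealth E n w <= (alpha^-1)%:E.
Proof.
split=> [tw n /andP[n0 nt]|H].
  rewrite leNgt; apply/negP => wn; move: tw; rewrite ltNge => /negP; apply.
  rewrite (@le_trans _ _ n%:R%:E)//; last by rewrite lee_fin ler_nat.
  by apply: ereal_inf_lbound; exists n.
(* Crossing happens at integer times, so if none is at most t the infimum is at least [t.+1]; this
   includes the empty set, whose infimum is +oo. *)
apply: (@lt_le_trans _ _ t.+1%:R%:E); first by rewrite lte_fin ltr_nat.
apply: le_ereal_inf_tmp => _ [n /= [n0 wn] <-]; rewrite lee_fin ler_nat ltnNge.
apply/negP => nt; move: wn; rewrite ltNge => /negP; apply.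
by apply: H; rewrite n0.
Qed.

Lemma seq_type2_error_le alpha t : (0 < t)%N ->
  seq_type2_error E PP1 alpha t <= type2_error E PP1 alpha t.
Proof.
move=> t0; rewrite /seq_type2_error /type2_error; apply: le_measure; rewrite ?inE.
- rewrite [X in measurable X](_ : _ = \bigcap_(n in [set n | (0 < n <= t)%N])
      [set w | wealth E n w <= (alpha^-1)%:E]).
    by apply: bigcap_measurableType => n _; exact: measurable_wealth_le.
  by apply/seteqP; split => w /= /crossing_timeP.
- exact: measurable_wealth_le.
- by move=> w /= /crossing_timeP; apply; rewrite t0 leqnn.
Qed.

End type2_errors.

(** * Passage to exponential rates as t tends to infinity *)

Section extended_limits.
Context (R : realType).
Implicit Type u : (\bar R)^nat.

Lemma limn_einf_ge u (a : \bar R) :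
  (\forall n \near \oo, a <= u n) -> a <= limn_einf u.
Proof.
move=> [N _ aN]; rewrite limn_einf_lim; apply: lime_ge; first exact: is_cvg_einfs.
exists N => // n /= Nn; apply: le_ereal_inf_tmp => _ [k /= nk <-].
by apply: aN => /=; exact: leq_trans nk.
Qed.

Lemma cvg_EFin_squeeze u (l : R) :
  (forall e : R, (0 < e)%R ->
    \forall n \near \oo, (l - e)%:E <= u n <= (l + e)%:E) ->
  u @ \oo --> l%:E.
Proof.
move=> ul; have fin : \forall n \near \oo, u n \is a fin_num.
  by apply: filterS (ul 1%R ltr01) => n; case: (u n) => // /andP[].
apply/fine_cvgP; split=> //; apply/cvgrPdist_le => e e0.
near=> n; have /andP[] : (l - e)%:E <= u n <= (l + e)%:E by near: n; exact: ul.
rewrite /= -(@fineK _ (u n)); last by near: n.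
by rewrite !lee_fin/= ler_distlC => -> ->.
Unshelve. all: by end_near. Qed.

End extended_limits.

Section asymptotics.
Context d (X : measurableType d) (R : realType) (P0 P1 : probability X R).
Variables (PP1 : probability (sequence_space X) R) (E : evariable P0).
Hypothesis prodP : infinite_product P1 PP1.
Hypothesis intE : P1.-integrable [set: X] (fun x => lne (E x)).
Hypothesis c_gt0 : 0 < mean_log P1 E.
Local Notation L := (log_evar E).
Local Notation mL := (measurable_log_evar E).

Lemma exponent_ge0 : 0 <= exponent P1 E.
Proof.
apply: ereal_sup_ubound; exists 0%R => /=; first by [].
by rewrite /tilted_exponent oppr0 moment0// lne1 oppe0.
Qed.

Lemma tilted_exponent_le_rate alpha s e : (0 < alpha < 1)%R -> (0 <= s)%R -> (0 < e)%R ->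
  \forall t \near \oo, tilted_exponent P1 E s - e%:E <=
    - ((t%:R^-1)%:E * lne (type2_error E PP1 alpha t)).
Proof.
move=> /andP[a0 a1] s0 e0.
(* From here on the contribution s ell / t of the level is at most [e], so the rate forgets
   alpha. *)
have : \forall t \near \oo, (s * ln alpha^-1 / e <= t%:R :> R)%R.
  exact: nbhs_infty_ger.
have : \forall t \near \oo, (0 < t)%N by exact: nbhs_infty_gt.
apply: filterS2 => t t0 tl.
have := @type2_error_le_tilt _ _ _ _ _ _ _ prodP intE alpha t s a0 t0 s0.
rewrite /tilt_objective; have := tilted_exponent_lty intE s.
case: (tilted_exponent P1 E s) => [r||]// _; last by rewrite addNye leNye.
have tR : (0 < t%:R :> R)%R by rewrite ltr0n.
rewrite -muleN => H; rewrite -(@lee_pmul2l _ t%:R%:E)// ?lte_fin//.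
have -> : t%:R%:E * (t%:R^-1%:E * - lne (type2_error E PP1 alpha t)) =
    - lne (type2_error E PP1 alpha t).
  by rewrite muleA -[t%:R%:E * _]EFinM divff ?gt_eqF// mul1e.
apply: le_trans H.
rewrite lee_fin.
by move: tl; rewrite ler_pdivrMr// => tl; lra.
Qed.

Lemma seq_rate_ge alpha : (0 < alpha < 1)%R ->
  exponent P1 E <= limn_einf (fun t : nat =>
       - ((t%:R^-1)%:E * lne (seq_type2_error E PP1 alpha t))).
Proof.
move=> a01; apply: ge_ereal_sup => _ [s /= s0 <-].
have := tilted_exponent_lty intE s.
case Es : (tilted_exponent P1 E s) => [r||]// _; last by rewrite leNye.
apply/lee_addgt0Pr => e e0; rewrite -leeBlDr//; apply: limn_einf_ge.
have := tilted_exponent_le_rate a01 s0 e0; rewrite Es.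
have : \forall t \near \oo, (0 < t)%N by exact: nbhs_infty_gt.
apply: filterS2 => t t0 /le_trans; apply.
rewrite leeN2 lee_pmul2l ?lte_fin ?invr_gt0 ?ltr0n//.
rewrite lee_lne ?in_itv/= ?leey ?andbT; first exact: seq_type2_error_le.
- by rewrite /seq_type2_error measure_ge0.
- by rewrite /type2_error measure_ge0.
Qed.

(** The supremum defining I(x) read backwards, one tilt at a time; in this form the interior
    hypothesis enters the lower bound. *)
Lemma moment_ge_cramer_rate (x C u : R) : cramer_rate P1 E x <= C%:E ->
  (expR (u * x - C))%:E <= moment P1 E u.
Proof.
move=> xC; have : (u * x)%:E - lne (moment P1 E u) <= C%:E.
  by apply: le_trans xC; apply: ereal_sup_ubound; exists u.
have := moment_gt0 intE u.
case: (moment P1 E u) => [m||]//; last by rewrite leey.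
rewrite lte_fin => m0; rewrite lne_EFin// -EFinB !lee_fin => H.
by rewrite -[leRHS]lnK ?posrE// ler_expR; lra.
Qed.

(** The tilt s of the exponent is - l in the Cramer rate. For l > 0, Jensen and c > 0 make the
    moment at least 1, so such l contribute nothing positive. *)
Lemma exponent_eq_cramer_rate0 : exponent P1 E = cramer_rate P1 E 0.
Proof.
apply/eqP; rewrite eq_le; apply/andP; split; apply: ge_ereal_sup => _ [s /= s0 <-].
  apply: ereal_sup_ubound; exists (- s)%R => //.
  by rewrite mulr0 add0e.
rewrite mulr0 add0e; have [s_le0|s_gt0] := leP s 0%R.
  apply: ereal_sup_ubound; exists (- s)%R => /=; first by rewrite oppr_ge0.
  by rewrite /tilted_exponent opprK.
apply: le_trans exponent_ge0; rewrite oppe_le0 lne_ge0.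
apply: le_trans (moment_ge intE s); rewrite lee_fin -expR0 ler_expR.
by rewrite mulr_ge0 ?(ltW s_gt0)// fine_ge0// ltW.
Qed.

End asymptotics.

(** * Cramer's lower bound for the wealth and the limit of the fixed-horizon error *)

Section cramer.
Context d (X : measurableType d) (R : realType) (P0 P1 : probability X R).
Variables (PP1 : probability (sequence_space X) R) (E : evariable P0).
Hypothesis prodP : infinite_product P1 PP1.
Hypothesis intE : P1.-integrable [set: X] (fun x => lne (E x)).
Hypothesis c_gt0 : 0 < mean_log P1 E.
Local Notation L := (log_evar E).
Local Notation mL := (measurable_log_evar E).

(* [deviation_lower_bound] only yields two-sided windows of linear width, so it
   is applied to [log E + kap], whose window [-kap t, kap t] becomes
   [-2 kap t, 0]; convexity of the rate between [- rho] and [0] makes the shift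
   cost arbitrarily little. *)
Lemma type2_error_ge alpha (r C rho e : R) : (0 < alpha < 1)%R ->
    (0 <= r)%R -> (0 <= C)%R -> (0 < rho)%R -> (0 < e)%R ->
    cramer_rate P1 E 0 <= r%:E -> cramer_rate P1 E rho <= C%:E ->
    cramer_rate P1 E (- rho)%R <= C%:E ->
  \forall t \near \oo,
    (expR (- (r + e) * t%:R))%:E <= type2_error E PP1 alpha t.
Proof.
move=> /andP[a0 a1] r0 C0 rho0 e0 I0 Ip In.
have C10 : (0 < C + 1)%R by lra.
pose kap := Order.min (rho / 2)%R (rho * (e / 2) / (C + 1))%R.
have kap0 : (0 < kap)%R.
  by rewrite lt_min !divr_gt0// mulr_gt0// divr_gt0.
have kap_rho : (kap <= rho / 2)%R by rewrite ge_min lexx.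
have kap_C : (kap * (C + 1) <= rho * (e / 2))%R.
  by rewrite -ler_pdivlMr// ge_min lexx orbT.
pose V x := (L x + kap)%R.
have mV : measurable_fun [set: X] V by apply: measurable_funD => //; exact: mL.
have VE u : \int[P1]_x (expR (u * V x))%:E = (expR (u * kap))%:E * moment P1 E u.
  rewrite momentE// -ge0_integralZl//.
  - by apply: eq_integral => x _; rewrite /V mulrDr expRD EFinM muleC.
  - by apply/measurable_EFinP; exact: (measurable_expR_mul mL).
have VgeE (y z u : R) : (y <= u * kap + z)%R -> (expR z)%:E <= moment P1 E u ->
    (expR y)%:E <= \int[P1]_x (expR (u * V x))%:E.
  move=> yz zu; rewrite VE (@le_trans _ _ ((expR (u * kap))%:E * (expR z)%:E))//.
    by rewrite -EFinM -expRD lee_fin ler_expR.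
  by rewrite lee_wpmul2l// lee_fin expR_ge0.
(* B rho = 2 (C + 1): at tilts [B] and [- B] the lower bound for log E has exponent B rho - C, of
   which the shift takes at most B rho / 2, and at least 1 remains. *)
pose B := (2 * (C + 1) / rho)%R.
have B0 : (0 < B)%R by rewrite divr_gt0// mulr_gt0.
have Brho : (B * rho = 2 * (C + 1))%R by rewrite /B divfK// gt_eqF.
have MB : 1 < \int[P1]_x (expR (B * V x))%:E.
  apply: (@lt_le_trans _ _ (expR 1)%:E); first by rewrite lte_fin expR_gt1.
  apply: VgeE (moment_ge_cramer_rate intE B Ip).
  by have := mulr_gt0 B0 kap0; lra.
have MNB : 1 < \int[P1]_x (expR (- B * V x))%:E.
  apply: (@lt_le_trans _ _ (expR 1)%:E); first by rewrite lte_fin expR_gt1.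
  apply: VgeE (moment_ge_cramer_rate intE (- B) In).
  by have := ler_wpM2l (ltW B0) kap_rho; rewrite mulrNN Brho mulNr mulrA Brho; lra.
have MA u : (- B <= u <= B)%R ->
    (expR (- (r + e / 2)))%:E <= \int[P1]_x (expR (u * V x))%:E.
  (* [z] is the better of the bounds from I(0) and I(- rho). Averaging them with weights 1 - kap /
     rho and kap / rho cancels the term u kap of the shift, and the loss is at most kap C / rho <= e
     / 2. *)
  move=> _; pose z := Order.max (- r)%R (- (u * rho) - C)%R.
  apply: (@VgeE _ z).
    have zr : (- r <= z)%R by rewrite le_max lexx.
    have zu : (- (u * rho) - C <= z)%R by rewrite le_max lexx orbT.
    have k1 : (0 <= rho - kap)%R by lra.
    have := ler_wpM2l k1 zr; have := ler_wpM2l (ltW kap0) zu => H1 H2.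
    have kr : (0 <= kap * r)%R by rewrite mulr_ge0// ltW.
    rewrite -(ler_pM2l rho0); lra.
  rewrite /z; case: (leP (- r)%R) => _.
    by have := moment_ge_cramer_rate intE u In; rewrite mulrN.
  by have := moment_ge_cramer_rate intE u I0; rewrite mulr0 add0r.
have := deviation_lower_bound prodP mV B0 kap0 (divr_gt0 e0 (ltr0n R 2)) MA MB MNB.
apply: filterS => t; rewrite -addrA -splitr => /le_trans; apply.
rewrite (type2_errorE prodP intE)//; apply: le_measure; rewrite ?inE.
- exact: measurable_norm_sum_le.
- exact: (measurable_sum_le mL).
(* The sum of log E plus kap t is at most kap t, so the sum of log E is at most 0, hence at most ln
   (1 / alpha) since alpha < 1. *)
move=> w /=; rewrite big_split/= sumr_const card_ord mulr_natr.
move=> /(le_trans (ler_norm _)); rewrite gerDr => /le_trans; apply.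
by rewrite ln_ge0// invf_ge1// ltW.
Qed.

Lemma cramer_limit alpha : [set x : R | cramer_rate P1 E x < +oo]° 0%R ->
    (0 < alpha < 1)%R ->
  (t%:R^-1)%:E * lne (type2_error E PP1 alpha t) @[t --> \oo] --> - exponent P1 E.
Proof.
move=> [rho0 /= rho00 Ifin] a01.
have I_lty (x : R) : (`|x| < rho0)%R -> cramer_rate P1 E x < +oo.
  by move=> xr; apply: Ifin => /=; rewrite sub0r normrN.
have H0 := exponent_ge0 intE.
have I0 := I_lty 0%R; rewrite normr0 in I0; have {}I0 := I0 rho00.
move: H0 I0; rewrite -(exponent_eq_cramer_rate0 intE c_gt0).
case Er : (exponent P1 E) => [r||]//; rewrite lee_fin => r0 _.
pose rho := (rho0 / 2)%R.
have rho_gt0 : (0 < rho)%R by rewrite divr_gt0.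
have rho_lt : (rho < rho0)%R by rewrite ltr_pdivrMr// ltr_pMr// ltr1n.
have bnd (y : \bar R) : y < +oo -> exists C : R, y <= C%:E.
  by case: y => [y||]// _; [exists y; rewrite lexx|exists 0%R; rewrite leNye].
have [C1 IC1] : exists C : R, cramer_rate P1 E rho <= C%:E.
  by apply/bnd/I_lty; rewrite gtr0_norm.
have [C2 IC2] : exists C : R, cramer_rate P1 E (- rho)%R <= C%:E.
  by apply/bnd/I_lty; rewrite normrN gtr0_norm.
pose C := Order.max 0%R (Order.max C1 C2).
have C0 : (0 <= C)%R by rewrite le_max lexx.
have I0r : cramer_rate P1 E 0 <= r%:E.
  by rewrite -(exponent_eq_cramer_rate0 intE c_gt0) Er.
have Ip : cramer_rate P1 E rho <= C%:E.
  by apply: le_trans IC1 _; rewrite lee_fin !le_max lexx orbT.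
have In : cramer_rate P1 E (- rho)%R <= C%:E.
  by apply: le_trans IC2 _; rewrite lee_fin !le_max lexx !orbT.
rewrite -EFinN; apply: cvg_EFin_squeeze => e e0.
have e20 : (0 < e / 2)%R by rewrite divr_gt0.
(* The supremum may fail to be attained, so the Chernoff side uses a tilt within e / 2 of it. *)
have [s /= s0 rs] : exists2 s : R, (0 <= s)%R & (r - e / 2)%:E < tilted_exponent P1 E s.
  have : (r - e / 2)%:E < exponent P1 E by rewrite Er lte_fin ltrBlDr ltrDl.
  by move=> /ereal_sup_gt[_ [s s0 <-]] ?; exists s.
have lower := type2_error_ge a01 r0 C0 rho_gt0 e0 I0r Ip In.
have upper := tilted_exponent_le_rate prodP intE a01 s0 e20.
have t_gt0 : \forall t \near \oo, (0 < t)%N by exact: nbhs_infty_gt.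
near=> t.
have t0 : (0 < t%:R :> R)%R by rewrite ltr0n; near: t.
apply/andP; split.
  have lt : (expR (- (r + e) * t%:R))%:E <= type2_error E PP1 alpha t by near: t.
  have : lne (expR (- (r + e) * t%:R))%:E <= lne (type2_error E PP1 alpha t).
    by rewrite lee_lne// in_itv/= leey andbT ?lee_fin ?expR_ge0//.
  rewrite lne_EFin ?expR_gt0// expRK => H.
  apply: (@le_trans _ _ (t%:R^-1%:E * (- (r + e) * t%:R)%:E)).
    by rewrite -EFinM lee_fin mulrCA mulVf ?gt_eqF// mulr1 opprD.
  by rewrite lee_pmul2l// lte_fin invr_gt0.
rewrite -leeN2 (@le_trans _ _ (tilted_exponent P1 E s - (e / 2)%:E))//; last by near: t.
rewrite leeBrDr// -EFinD; apply: le_trans (ltW rs).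
by rewrite lee_fin; lra.
Unshelve. all: by end_near. Qed.

End cramer.

(** * The tilted law and the equation of the optimising tilt *)

Section tilt.
Context d (X : measurableType d) (R : realType) (P0 P1 : probability X R).
Variable E : evariable P0.
Hypothesis intE : P1.-integrable [set: X] (fun x => lne (E x)).
Local Notation L := (log_evar E).
Local Notation mL := (measurable_log_evar E).
Local Notation m := (fun u => \int[P1]_x expR (u * L x))%R.

Lemma moment_fin u : moment P1 E u < +oo -> moment P1 E u = (m u)%:E.
Proof.
move=> mu; rewrite /Rintegral -(momentE intE) fineK//.
by rewrite ge0_fin_numE// ltW// moment_gt0.
Qed.

Lemma integrable_moment u : moment P1 E u < +oo ->
  P1.-integrable [set: X] (fun x => (expR (u * L x))%:E).
Proof.
rewrite (momentE intE) => mu; apply/integrableP; split.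
  by apply/measurable_EFinP; exact: (measurable_expR_mul mL).
by under eq_integral do rewrite gee0_abs ?lee_fin ?expR_ge0//.
Qed.

Lemma moment_lty s : -oo < tilted_exponent P1 E s -> moment P1 E (- s) < +oo.
Proof.
rewrite /tilted_exponent.
by case: (moment P1 E (- s)) => [r||] /=; rewrite ?ltry ?ltxx ?ltNyy.
Qed.

Lemma tiltedE s : moment P1 E (- s) < +oo -> forall B, measurable B ->
  tilted P1 E s B = \int[P1]_(x in B) (expR (- s * L x) / m (- s))%:E.
Proof.
move=> ms B mB; have mgt := moment_gt0 intE (- s).
rewrite /tilted; apply: ae_eq_integral => //.
- by apply: measurable_funTS; exact: measurable_tilted_density.
- apply/measurable_EFinP/measurable_funTS; apply: measurable_funM => //.
  exact: (measurable_expR_mul mL).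
- apply: filterS (lne_evar_ae intE) => x H _.
  rewrite /tilted_density moment_fin// /epow H inver gt_eqF//.
  by move: mgt; rewrite moment_fin// lte_fin.
Qed.

Lemma integral_tilted s : moment P1 E (- s) < +oo ->
  P1.-integrable [set: X] (fun x => (L x * expR (- s * L x))%:E) ->
  \int[tilted P1 E s]_x lne (E x) =
  ((\int[P1]_x (L x * expR (- s * L x)))%R / m (- s))%:E.
Proof.
move=> ms iL.
have mexp := measurable_expR_mul mL (- s).
have m0 : (0 < m (- s))%R.
  by have := moment_gt0 intE (- s); rewrite moment_fin// lte_fin.
rewrite (@integral_density _ _ _ _ _ P1 (tilted P1 E s) id
  (fun x => expR (- s * L x) / m (- s))%R)//; last 4 first.
- exact: measurable_funM.
- by move=> x; rewrite divr_ge0 ?expR_ge0 ?ltW.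
- exact: tiltedE.
- exact: measurable_lne_evar.
transitivity (\int[P1]_x ((m (- s))^-1%:E * (L x * expR (- s * L x))%:E)).
  apply: ae_eq_integral => //.
  - apply: emeasurable_funM; first exact: measurable_lne_evar.
    by apply/measurable_EFinP; exact: measurable_funM.
  - apply: emeasurable_funM => //; apply/measurable_EFinP.
    by apply: measurable_funM => //; exact: mL.
  - apply: filterS (lne_evar_ae intE) => x H _; rewrite H -!EFinM.
    by congr (_%:E); ring.
rewrite [LHS]integralZl// [in RHS]mulrC [RHS]EFinM; congr (_ * _).
by rewrite /Rintegral fineK//; exact: integrable_fin_num.
Qed.

(** Fermat's rule at an interior point, where the moment is differentiable and the constraint u >= 0
    does not bind. At the boundary the equation can fail: s = 0 is optimal when c < ell / t,
    although the mean of log E under Q_0 = P1 is c. *)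
Lemma optimising_tilt_mean ell t s : (0 < t)%N -> optimising_tilt P1 E t ell s ->
    [set u : R | (0 <= u)%R /\ -oo < tilted_exponent P1 E u]° s ->
  \int[tilted P1 E s]_x lne (E x) = (ell / t%:R)%:E.
Proof.
have obj_le (k a b x y : R) :
    (k * - a - x <= k * - b - y)%R -> (k * b + y <= k * a + x)%R by lra.
move=> t0 [s0 sopt] [rho /= rho0 nbhs_s].
have tR : (0 < t%:R :> R)%R by rewrite ltr0n.
have near_s u : (`|s - u| < rho)%R ->
    (0 <= u)%R /\ moment P1 E (- u) < +oo.
  by move=> /nbhs_s[u0 /moment_lty].
(* Differentiating at [u] requires finite moments at u + del and u - del; for [u] within [del] of
   [s] these stay within rho / 2 of [s]. *)
pose del := (rho / 4)%R.
have del0 : (0 < del)%R by rewrite divr_gt0.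
have dm u : (`|s - u| < del)%R -> P1.-integrable [set: X]
    (fun x => (L x * expR (- u * L x))%:E) /\
    is_derive (- u)%R (1%R : R) m (\int[P1]_x (L x * expR (- u * L x)))%R.
  rewrite ltr_distl => /andP[su us].
  have i1 : P1.-integrable [set: X] (fun x => (expR ((- u + del) * L x))%:E).
    rewrite [(- u + del)%R]addrC -opprB; apply: integrable_moment.
    apply: (near_s _ _).2; rewrite ltr_distl /del in su us *; lra.
  have i2 : P1.-integrable [set: X] (fun x => (expR ((- u - del) * L x))%:E).
    rewrite -opprD; apply: integrable_moment.
    apply: (near_s _ _).2; rewrite ltr_distl /del in su us *; lra.
  split; first exact: (integrable_mul_expR_mul measurableT mL del0 i1 i2).
  exact: (is_derive_integral_expR measurableT mL del0 i1 i2).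
have ss : (`|s - s| < del)%R by rewrite subrr normr0.
have mfin u : (`|s - u| < del)%R -> moment P1 E (- u) = (m (- u))%:E.
  move=> su; apply/moment_fin/(near_s _ _).2; apply: lt_le_trans su _.
  by rewrite /del ler_pdivrMr// ler_peMr ?ler1n// ltW.
have mpos u : (`|s - u| < del)%R -> (0 < m (- u))%R.
  by move=> /mfin mE; rewrite -lte_fin -mE; exact: moment_gt0.
have [iL _] := dm s ss.
rewrite integral_tilted//; last by rewrite mfin// ltry.
congr (_%:E); set D := (\int[P1]_x (L x * expR (- s * L x)))%R.
(* The negative of the tilt objective near [s], as a real function; a maximiser of the objective is
   a minimiser of [f]. *)
pose f u := (t%:R * ln (m (- u)) + u * ell)%R.
have df u : (`|s - u| < del)%R -> is_derive u (1%R : R) f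
    (t%:R * ((m (- u))^-1 * - (\int[P1]_x (L x * expR (- u * L x)))%R) + ell)%R.
  move=> su; have [_ dmu] := dm u su; have := mpos u su => mu0.
  have dN : is_derive u (1%R : R) (- @id R)%R (- 1)%R by exact: is_deriveN.
  have dln := is_derive1_comp (is_derive1_ln mu0) (is_derive1_comp dmu dN).
  have dsum := is_deriveD (is_deriveZ (t%:R : R) dln)
    (is_deriveZ ell (is_derive_id u (1%R : R))).
  rewrite (_ : f = (t%:R \*: (@ln R \o (m \o (- @id R))) + ell \*: @id R)%R); last first.
    by apply/funext => v; rewrite /f [(v * ell)%R]mulrC.
  by apply: (is_derive_eq dsum); rewrite mulrN1 /GRing.scale/= mulr1.
have : is_derive s (1%R : R) f 0%R.
  apply: (@derive1_at_min _ f (s - del)%R (s + del)%R); first lra.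
  - move=> u; rewrite in_itv/= => /andP[su us].
    by case: (df u) => //; rewrite ltr_distl; apply/andP; split; lra.
  - by rewrite in_itv/=; apply/andP; split; lra.
  - move=> u; rewrite in_itv/= => /andP[su us].
    have us' : (`|s - u| < del)%R by rewrite ltr_distl; apply/andP; split; lra.
    have [|u0 _] := near_s u.
      by rewrite ltr_distl; apply/andP; split; rewrite /del in su us; lra.
    have := sopt u u0; rewrite /tilt_objective /tilted_exponent !mfin//.
    rewrite (lne_EFin (mpos u us')) (lne_EFin (mpos s ss)) lee_fin => H.
    exact: obj_le H.
case: (df s ss) => _ dfs [_]; rewrite dfs -/D => /eqP.
rewrite mulrN mulrN addrC subr_eq0 [(_^-1 * _)%R]mulrC => /eqP ->.
by rewrite [RHS]mulrC mulKf ?gt_eqF.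
Qed.

End tilt.

Theorem corollary4p35 (R : realType) (d : measure_display)
    (X : measurableType d) (P0 P1 : probability X R)
    (PP1 : probability (sequence_space X) R) (E : evariable P0)
    (domP : P1 `<< P0)
    (prodP : infinite_product P1 PP1)
    (intE : P1.-integrable [set: X] (fun x => lne (E x))) :
  let c := mean_log P1 E in
  let Lambda := tilted_exponent P1 E in
  let psi := fun s : R => s%:E * c - Lambda s in
  0 < c ->
  0 <= exponent P1 E /\
  (forall s : R, (0 <= s)%R -> acgf P1 E s = psi s) /\
  majorant P1 E psi /\
  (forall psi' : R -> \bar R, majorant P1 E psi' ->
     forall s : R, (0 <= s)%R -> psi s <= psi' s) /\
  (forall x : R, (0 <= x)%R ->
     rate psi x =
     ereal_sup [set Lambda s - s%:E * (c - x%:E) | s in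
                  [set s : R | (0 <= s)%R]]) /\
  (forall (alpha : R) (t : nat) (s : R),
     (0 < alpha < 1)%R -> (0 < t)%N ->
     optimising_tilt P1 E t (ln alpha^-1) s ->
     [set u : R | (0 <= u)%R /\ -oo < Lambda u]° s ->
     \int[tilted P1 E s]_x lne (E x) = (ln alpha^-1 / t%:R)%:E) /\
  (forall (alpha : R) (t : nat), (0 < alpha < 1)%R -> (0 < t)%N ->
     type2_error E PP1 alpha t <=
     expeR (- ereal_sup [set t%:R%:E * Lambda s - (s * ln alpha^-1)%:E | s in
                           [set s : R | (0 <= s)%R]])) /\
  ([set x : R | cramer_rate P1 E x < +oo]° 0%R ->
   forall alpha : R, (0 < alpha < 1)%R ->
     (t%:R^-1)%:E * lne (type2_error E PP1 alpha t) @[t --> \oo]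
       --> - exponent P1 E) /\
  (forall (alpha : R) (t : nat), (0 < alpha < 1)%R -> (0 < t)%N ->
     seq_type2_error E PP1 alpha t <= type2_error E PP1 alpha t) /\
  (forall alpha : R, (0 < alpha < 1)%R ->
     exponent P1 E <=
     limn_einf (fun t : nat =>
       - ((t%:R^-1)%:E * lne (seq_type2_error E PP1 alpha t)))).
Proof.
move=> c Lambda psi c0.
have psiE s : acgf P1 E s = psi s by exact: acgfE.
split; first exact: exponent_ge0.
split; first by move=> s _; exact: psiE.
split.
  split=> [s s0||s s0]; last by rewrite psiE.
    by rewrite -psiE; exact: acgf_ge0.
  by rewrite /psi mul0e add0e /Lambda /tilted_exponent oppeK oppr0 moment0// lne1.
split; first by move=> psi' [_ _ H] s s0; rewrite -psiE; exact: H.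
split.
  move=> x x0; congr ereal_sup; apply: eq_imagel => s _.
  have cfin : c \is a fin_num by exact: mean_log_fin_num.
  rewrite /psi -(fineK cfin); have := tilted_exponent_lty intE s.
  rewrite -/Lambda; case: (Lambda s) => [r||]// _.
  by rewrite -EFinB -!EFinM -!EFinB; congr (_%:E); ring.
split.
  by move=> alpha t s a01 t0; exact: optimising_tilt_mean.
split; first by move=> alpha t /andP[a0 _] t0; exact: type2_error_le.
split; first by move=> H alpha a01; exact: cramer_limit.
split; first by move=> alpha t _ t0; exact: seq_type2_error_le.
by move=> alpha a01; exact: seq_rate_ge.
Qed.
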